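(* Let $A$ be a tournament on strategies $\{1,\dots,m\}$ with Nash equilibrium $\vec a$, and let $B$ be a tournament on strategies $\{1',\dots,n'\}$ with Nash equilibrium $\vec b$. Let $C$ be the tournament obtained from $A$ by substituting $B$ for strategy $m$: its strategies are $1,\dots,m-1,1',\dots,n'$; for $i,j\le m-1$, $i$ beats $j$ in $C$ iff $i$ beats $j$ in $A$; for $k',l'$ strategies of $B$, $k'$ beats $l'$ in $C$ iff $k'$ beats $l'$ in $B$; and for $i\le m-1$ and any $k'$, $i$ beats $k'$ in $C$ iff $i$ beats $m$ in $A$ (otherwise $k'$ beats $i$). Then the Nash equilibrium of $C$ (with strategies ordered $1,\dots,m-1,1',\dots,n'$) is $\langle a_1,a_2,\dots,a_{m-1},a_mb_1,a_mb_2,\dots,a_mb_n\rangle$.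
   Context: A Rock Paper Scissors variant is given by a tournament on a finite set of strategies: for distinct strategies $i,j$ exactly one of ''$i$ beats $j$'' or ''$j$ beats $i$'' holds. Define $g_{ij}=2$ if $i$ beats $j$, $g_{ii}=1$, and $g_{ij}=0$ if $j$ beats $i$. A strategy profile is a vector of nonnegative probabilities indexed by the strategies summing to $1$. A Nash equilibrium is a strategy profile $\vec a$ such that for every strategy profile $\vec b$, $\sum_{i,j} g_{ij}a_ib_j\ge 1$; such games have a unique Nash equilibrium. *)

(* Defs.v *)
From mathcomp Require Import all_boot all_order all_algebra.
Set Implicit Arguments.
Unset Strict Implicit.
Unset Printing Implicit Defensive.
Import Order.TTheory GRing.Theory Num.Theory.
Local Open Scope ring_scope.

Record tournament (n : nat) := Tournament {
  beats :> rel 'I_n;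
  beats_irr : irreflexive beats;
  beats_xor : forall i j : 'I_n, i != j -> beats i j (+) beats j i
}.

Definition payoff (R : realFieldType) (n : nat) (A : tournament n)
    (i j : 'I_n) : R :=
  if i == j then 1 else if A i j then 2 else 0.

Definition is_profile (R : realFieldType) (n : nat) (a : 'rV[R]_n) : Prop :=
  (forall i, 0 <= a 0 i) /\ \sum_i a 0 i = 1.

Definition is_nash (R : realFieldType) (n : nat) (A : tournament n)
    (a : 'rV[R]_n) : Prop :=
  is_profile a /\
  forall b : 'rV[R]_n, is_profile b ->
    1 <= \sum_i \sum_j payoff R A i j * a 0 i * b 0 j.

(* The strategies of [A : tournament m.+1] other than the last one,
   [ord_max], are the images of ['I_m] under [old]. *)
Definition old (m : nat) (i : 'I_m) : 'I_m.+1 := widen_ord (leqnSn m) i.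

Lemma old_inj m : injective (@old m).
Proof. by move=> i j /(congr1 val) /= ij; apply: val_inj. Qed.

Lemma old_neq_max m (i : 'I_m) : old i != ord_max.
Proof. by rewrite -val_eqE /= ltn_eqF. Qed.

(* In ['I_(m + n)], [split x] is [inl i] for the i-th kept strategy of [A] and
   [inr k] for the k-th strategy of [B]. *)
Definition subst_beats (m n : nat) (A : tournament m.+1) (B : tournament n) :
    rel 'I_(m + n) :=
  fun x y => match split x, split y with
    | inl i, inl j => A (old i) (old j)
    | inr k, inr l => B k l
    | inl i, inr _ => A (old i) ord_max
    | inr _, inl j => ~~ A (old j) ord_max
    end.

Lemma subst_irr m n (A : tournament m.+1) (B : tournament n) :
  irreflexive (subst_beats A B).
Proof. by move=> x; rewrite /subst_beats; case: split => i; apply: beats_irr. Qed.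

Lemma subst_xor m n (A : tournament m.+1) (B : tournament n) x y :
  x != y -> subst_beats A B x y (+) subst_beats A B y x.
Proof.
rewrite -(inj_eq (can_inj (@splitK m n))) /subst_beats.
case: (split x) => i; case: (split y) => j neq_ij.
- by apply: beats_xor; rewrite (inj_eq (@old_inj m)).
- by case: (A _ _).
- by case: (A _ _).
- exact: beats_xor.
Qed.

Definition subst_last (m n : nat) (A : tournament m.+1) (B : tournament n) :
    tournament (m + n) :=
  Tournament (@subst_irr m n A B) (@subst_xor m n A B).

(* Main.v *)
Require Import Defs.
From mathcomp Require Import all_boot all_order all_algebra.
Import Order.TTheory GRing.Theory Num.Theory.
Local Open Scope ring_scope.

(** A profile is an equilibrium iff it earns at least [1] against every pure
    strategy.  Against a kept strategy, the substituted profile earns what [a]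
    earns in [A]; against the [l]-th strategy of [B] it earns what [a] earns
    against the last strategy of [A], the term [a_m] being replaced by [a_m]
    times the payoff of [b] against [l], which is at least [1].

    Uniqueness holds in every tournament.  Since [g_ij + g_ji = 2], two
    equilibria [p], [q] earn exactly [1] against each other and against
    themselves, hence exactly [1] against each pure strategy in the union of
    their supports; so [p - q] is supported there and annihilated by the
    corresponding columns of [g].  As [g] is congruent to the identity
    modulo [2], its principal minors are odd integers, and [p = q]. *)

Definition pure_payoff {R : realFieldType} {n : nat} (A : tournament n)
    (a : 'rV[R]_n) (j : 'I_n) : R :=
  \sum_i payoff R A i j * a 0 i.

Lemma payoff_sym (R : realFieldType) n (A : tournament n) (i j : 'I_n) :
  payoff R A i j + payoff R A j i = 2.
Proof.
rewrite /payoff [j == i]eq_sym; case: eqVneq => // /(beats_xor A).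
by case: (A i j); case: (A j i) => //= _; rewrite ?addr0 ?add0r.
Qed.

Lemma payoff_sumE (R : realFieldType) n (A : tournament n) (a b : 'rV[R]_n) :
  \sum_i \sum_j payoff R A i j * a 0 i * b 0 j =
  \sum_j pure_payoff A a j * b 0 j.
Proof. by rewrite exchange_big; apply: eq_bigr => j _; rewrite mulr_suml. Qed.

Lemma is_profile_delta (R : realFieldType) n (j : 'I_n) :
  is_profile (delta_mx 0 j : 'rV[R]_n).
Proof.
split=> [i|]; first by rewrite mxE ler0n.
rewrite (bigD1 j) //= big1 => [|i /negPf ne_ij]; rewrite mxE eqxx ?ne_ij //.
by rewrite eqxx addr0.
Qed.

(** The payoff against a mixed strategy is a weighted average of the pure payoffs; conversely, point
    masses are themselves profiles. *)
Lemma is_nashP (R : realFieldType) n (A : tournament n) (a : 'rV[R]_n) :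
  is_nash A a <-> is_profile a /\ forall j, 1 <= pure_payoff A a j.
Proof.
split=> -[pa ge1]; split=> //; last first.
  move=> b [b_ge0 b_sum1]; rewrite payoff_sumE -b_sum1.
  by apply: ler_sum => j _; rewrite ler_peMl.
move=> j; have := ge1 _ (is_profile_delta R n j).
rewrite payoff_sumE (bigD1 j) //= big1 => [|i /negPf ne_ij].
  by rewrite mxE !eqxx mulr1 addr0.
by rewrite mxE ne_ij mulr0.
Qed.

Lemma sum_payoff_sym (R : realFieldType) n (A : tournament n)
    (a b : 'rV[R]_n) : is_profile a -> is_profile b ->
  \sum_i \sum_j payoff R A i j * a 0 i * b 0 j +
  \sum_i \sum_j payoff R A i j * b 0 i * a 0 j = 2.
Proof.
move=> [_ a1] [_ b1]; rewrite [X in _ + X]exchange_big -big_split /=.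
transitivity (\sum_i 2 * a 0 i * \sum_j b 0 j).
  apply: eq_bigr => i _; rewrite -big_split mulr_sumr; apply: eq_bigr => j _ /=.
  by rewrite [X in _ + X]mulrAC -!mulrDl payoff_sym.
by rewrite b1 -mulr_suml -mulr_sumr a1 !mulr1.
Qed.

(** Complementary slackness: the excesses over [1], weighted by [b], are nonnegative and sum to [0],
    so each one vanishes on the support of [b]. *)
Lemma pure_payoff_eq1 (R : realFieldType) n (A : tournament n)
    (a b : 'rV[R]_n) (j : 'I_n) : is_nash A a -> is_nash A b ->
  b 0 j != 0 -> pure_payoff A a j = 1.
Proof.
move=> Na Nb bj_neq0; have [[pa ge_a] [pb ge_b]] := (Na, Nb).
(* The payoffs of [a] against [b] and of [b] against [a] are both at least [1] and add up to [2]. *)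
have sum1 : \sum_i \sum_k payoff R A i k * a 0 i * b 0 k = 1.
  apply/eqP; rewrite eq_le ge_a // andbT.
  rewrite -(lerD2r 1) -[leRHS](sum_payoff_sym R n A a b pa pb) lerD2l.
  exact: ge_b.
have /is_nashP[_ ge1] := Na; have [b_ge0 b_sum1] := pb.
have term_ge0 k : true -> 0 <= (pure_payoff A a k - 1) * b 0 k.
  by move=> _; rewrite mulr_ge0 // subr_ge0.
have /psumr_eq0P/(_ j isT)/eqP :
    \sum_k (pure_payoff A a k - 1) * b 0 k = 0.
  under eq_bigr do rewrite mulrBl mul1r.
  by rewrite sumrB -payoff_sumE sum1 b_sum1 subrr.
by move=> /(_ term_ge0); rewrite mulf_eq0 (negPf bj_neq0) orbF subr_eq0 => /eqP.
Qed.

Lemma odd_det_neq0 n (M : 'M[int]_n) :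
  map_mx (intr : int -> 'F_2) M = 1%:M -> \det M != 0.
Proof.
move=> M1; apply/eqP => /(congr1 (intr : int -> 'F_2)).
by rewrite -det_map_mx M1 det1 rmorph0 => /eqP; rewrite oner_eq0.
Qed.

(** An ordered field has characteristic zero, so a nonzero integer determinant stays nonzero in
    [R]. *)
Lemma mulmx_intr_inj (R : realFieldType) n (M : 'M[int]_n) (d : 'rV[R]_n) :
  \det M != 0 -> d *m map_mx intr M = 0 -> d = 0.
Proof.
move=> detM dM0; have M_unit : map_mx (intr : int -> R) M \in unitmx.
  by rewrite unitmxE det_map_mx unitfE intr_eq0.
by rewrite -[d](mulmxK M_unit) dM0 mul0mx.
Qed.

(* The columns of [g] indexed by [S], the others being those of the identity:
   its determinant is the principal minor of [g] on [S]. *)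
Definition payoff_minor {n : nat} (A : tournament n) (S : pred 'I_n) :
    'M[int]_n :=
  \matrix_(i, j) if S j then (if i == j then 1 else if A i j then 2 else 0)
                 else (i == j)%:R.

Lemma payoff_minor_mod2 n (A : tournament n) (S : pred 'I_n) :
  map_mx (intr : int -> 'F_2) (payoff_minor A S) = 1%:M.
Proof.
apply/matrixP => i j; rewrite !mxE.
by case: (S j); case: (i == j); case: (A i j) => //; apply/val_inj.
Qed.

Lemma intr_payoff_minor (R : realFieldType) n (A : tournament n)
    (S : pred 'I_n) (i j : 'I_n) :
  (payoff_minor A S i j)%:~R = if S j then payoff R A i j else (i == j)%:R.
Proof.
by rewrite mxE /payoff; case: (S j); case: (i == j); case: (A i j).
Qed.

Lemma nash_unique (R : realFieldType) n (A : tournament n) (p q : 'rV[R]_n) :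
  is_nash A p -> is_nash A q -> p = q.
Proof.
move=> Np Nq; apply/eqP; rewrite -subr_eq0; apply/eqP.
pose S : pred 'I_n := fun j => (p 0 j != 0) || (q 0 j != 0).
apply: (@mulmx_intr_inj R n (payoff_minor A S)).
  exact/odd_det_neq0/payoff_minor_mod2.
apply/rowP => j; rewrite !mxE.
under eq_bigr => i _ do rewrite [in X in _ * X]mxE intr_payoff_minor.
case: (boolP (S j)) => [Sj|].
  transitivity (pure_payoff A p j - pure_payoff A q j).
    by rewrite -sumrB; apply: eq_bigr => i _; rewrite !mxE mulrC mulrBr.
  (* Whichever of [p] and [q] has [j] in its support serves as the opponent of [r]. *)
  have eq1 (r : 'rV[R]_n) : is_nash A r -> pure_payoff A r j = 1.
    move=> Nr; case/orP: Sj; first exact: (pure_payoff_eq1 _ _ _ _ _ _ Nr Np).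
    exact: (pure_payoff_eq1 _ _ _ _ _ _ Nr Nq).
  by rewrite !eq1 // subrr.
(* Outside [S] the column is that of the identity, so it only picks out the [j]-th entry of
   [p - q]. *)
rewrite negb_or !negbK => /andP[/eqP pj0 /eqP qj0].
apply: big1 => i _; case: eqVneq => [->|_]; last by rewrite mulr0.
by rewrite !mxE pj0 qj0 subrr mul0r.
Qed.

Definition subst_profile {R : realFieldType} {m n : nat} (a : 'rV[R]_m.+1)
    (b : 'rV[R]_n) : 'rV[R]_(m + n) :=
  row_mx (\row_(i < m) a 0 (old i)) (\row_(k < n) (a 0 ord_max * b 0 k)).

Lemma subst_profile_is_profile (R : realFieldType) m n (a : 'rV[R]_m.+1)
    (b : 'rV[R]_n) :
  is_profile a -> is_profile b -> is_profile (subst_profile a b).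
Proof.
move=> [a_ge0 a1] [b_ge0 b1]; split=> [x|].
  by rewrite mxE; case: (split x) => k; rewrite mxE ?mulr_ge0.
rewrite big_split_ord /= -a1 big_ord_recr /=; congr (_ + _).
  by apply: eq_bigr => i _; rewrite row_mxEl mxE.
under eq_bigr do rewrite row_mxEr mxE.
by rewrite -mulr_sumr b1 mulr1.
Qed.

Section SubstPayoff.

Variables (R : realFieldType) (m n : nat).
Variables (A : tournament m.+1) (B : tournament n).

Let C := subst_last A B.

Lemma payoff_subst_ll (i j : 'I_m) :
  payoff R C (lshift n i) (lshift n j) = payoff R A (old i) (old j).
Proof.
rewrite /payoff (inj_eq (@lshift_inj m n)) (inj_eq (@old_inj m)) /=.
by rewrite /subst_beats !(unsplitK (inl _)).
Qed.

Lemma payoff_subst_lr (i : 'I_m) (l : 'I_n) :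
  payoff R C (lshift n i) (rshift m l) = payoff R A (old i) ord_max.
Proof.
rewrite /payoff eq_lrshift (negPf (old_neq_max i)) /=.
by rewrite /subst_beats (unsplitK (inl _)) (unsplitK (inr _)).
Qed.

Lemma payoff_subst_rl (k : 'I_n) (j : 'I_m) :
  payoff R C (rshift m k) (lshift n j) = payoff R A ord_max (old j).
Proof.
(* Adding the reversed payoff turns both sides into [2]. *)
apply: (addIr (payoff R C (lshift n j) (rshift m k))).
by rewrite payoff_sym payoff_subst_lr payoff_sym.
Qed.

Lemma payoff_subst_rr (k l : 'I_n) :
  payoff R C (rshift m k) (rshift m l) = payoff R B k l.
Proof.
rewrite /payoff (inj_eq (@rshift_inj m n)) /=.
by rewrite /subst_beats !(unsplitK (inr _)).
Qed.

Variables (a : 'rV[R]_m.+1) (b : 'rV[R]_n).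

Lemma pure_payoff_subst_l (j : 'I_m) : \sum_k b 0 k = 1 ->
  pure_payoff C (subst_profile a b) (lshift n j) = pure_payoff A a (old j).
Proof.
move=> b1; rewrite /pure_payoff big_split_ord big_ord_recr /=; congr (_ + _).
  by apply: eq_bigr => i _; rewrite payoff_subst_ll row_mxEl mxE.
under eq_bigr do rewrite payoff_subst_rl row_mxEr mxE mulrA.
by rewrite -mulr_sumr b1 mulr1.
Qed.

Lemma pure_payoff_subst_r (l : 'I_n) :
  pure_payoff C (subst_profile a b) (rshift m l) =
  pure_payoff A a ord_max + a 0 ord_max * (pure_payoff B b l - 1).
Proof.
rewrite /pure_payoff big_split_ord big_ord_recr /= -addrA; congr (_ + _).
  by apply: eq_bigr => i _; rewrite payoff_subst_lr row_mxEl mxE.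
under eq_bigr do rewrite payoff_subst_rr row_mxEr mxE mulrCA.
(* The diagonal payoff [1] of [ord_max] against itself accounts for the [- 1]. *)
by rewrite -mulr_sumr /payoff eqxx mul1r mulrBr mulr1 addrC subrK.
Qed.

Lemma subst_profile_nash :
  is_nash A a -> is_nash B b -> is_nash C (subst_profile a b).
Proof.
move=> /is_nashP[pa a_ge1] /is_nashP[pb b_ge1]; apply/is_nashP.
split=> [|x]; first exact: subst_profile_is_profile.
rewrite -(splitK x); case: (split x) => j /=.
  by rewrite pure_payoff_subst_l //; case: pb.
rewrite pure_payoff_subst_r (le_trans (a_ge1 ord_max)) // lerDl.
by rewrite mulr_ge0 ?subr_ge0 //; case: pa.
Qed.

End SubstPayoff.

Theorem theorem3p2 (R : realFieldType) (m n : nat)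
    (A : tournament m.+1) (B : tournament n)
    (a : 'rV[R]_m.+1) (b : 'rV[R]_n)
    (hA : is_nash A a) (hB : is_nash B b) :
  unique (is_nash (subst_last A B))
    (row_mx (\row_(i < m) a 0 (old i)) (\row_(k < n) (a 0 ord_max * b 0 k))).
Proof.
have nash_ab := subst_profile_nash R m n A B a b hA hB.
by split=> // x nash_x; apply: (nash_unique _ _ _ _ _ nash_ab nash_x).
Qed.
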